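(* Let $d\ge2$, let $\theta\in\mathbb{R}^d$ be a unit vector (in Euclidean norm), let $t\ge0$, and let $f(x)=1\{\theta^{\mathsf T}x>t\}$ for $x\in\mathbb{R}^d$, with $x\sim\mathcal{N}(0,I_d)$. Then $$\nu(f)\ge\frac{\|\theta\|_1}{\Phi(t)\Phi(-t)\,2^{3/2}\pi}\,e^{-t^2-1}.$$
   Context: $\Phi$ is the standard Gaussian cumulative distribution function and $\|\theta\|_1=\sum_{j=1}^d|\theta_j|$. Mean dimension: let $x=(x_1,\dots,x_d)$ have independent components (here $x\sim\mathcal{N}(0,I_d)$) and let $f$ be measurable with $E(f(x)^2)<\infty$. For $u\subseteq\{1,\dots,d\}$ the ANOVA components are defined recursively by $f_u(x)=E(f(x)\mid x_u)-\sum_{v\subsetneq u}f_v(x)$, where $x_u=(x_j)_{j\in u}$, so $f=\sum_u f_u$, the $f_u$ are mutually orthogonal in $L^2$, and $f_\emptyset=E(f(x))$. Put $\sigma_u^2=E(f_u(x)^2)$ for $u\neq\emptyset$ and $\sigma^2_\emptyset=0$, so $\sigma^2=\mathrm{Var}(f(x))=\sum_u\sigma_u^2$. When $\sigma^2>0$, the mean dimension of $f$ is $\nu(f)=\sum_u|u|\sigma_u^2\big/\sum_u\sigma_u^2$. *)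

(* Defs.v *)
From HB Require Import structures.
From mathcomp Require Import all_boot all_order all_algebra.
From mathcomp Require Import all_classical all_reals all_analysis.

Set Implicit Arguments.
Unset Strict Implicit.
Unset Printing Implicit Defensive.

Import Order.TTheory GRing.Theory Num.Theory.
Import numFieldNormedType.Exports.

Local Open Scope classical_set_scope.
Local Open Scope ring_scope.

Definition norm1 (R : realType) (d : nat) (x : 'cV[R]_d) : R :=
  \sum_(j < d) `|x j 0|.

Definition norm2 (R : realType) (d : nat) (x : 'cV[R]_d) : R :=
  Num.sqrt (\sum_(j < d) x j 0 ^+ 2).

Definition Phi (R : realType) (x : R) : R := fine (normal_prob 0 1 `]-oo, x]).

Definition independent_RVs (dT : measure_display) (T : measurableType dT)
    (R : realType) (P : probability T R) (d : nat) (X : 'I_d -> {RV P >-> R}) :=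
  forall (J : {set 'I_d}) (B : 'I_d -> set R),
    (forall j, measurable (B j)) ->
    (P (\bigcap_(j in [set` J]) (X j @^-1` B j)) =
     \prod_(j in J) P (X j @^-1` B j))%E.

(* The distributions are compared on measurable sets only, because the values
   of normal_prob on the other sets are meaningless. *)
Definition standard_gaussian (dT : measure_display) (T : measurableType dT)
    (R : realType) (P : probability T R) (d : nat) (X : 'I_d -> {RV P >-> R}) :=
  independent_RVs X /\
  forall (j : 'I_d) (B : set R), measurable B ->
    distribution P (X j) B = normal_prob 0 1 B.

Definition is_cond_exp (dT : measure_display) (T : measurableType dT)
    (R : realType) (P : probability T R) (G : set_system T) (Y Z : T -> R) :=
  [/\ forall B : set R, measurable B -> G (Z @^-1` B),
      P.-integrable [set: T] (EFin \o Z) &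
      forall A, G A ->
        (\int[P]_(w in A) (Z w)%:E = \int[P]_(w in A) (Y w)%:E)%E].

(* Some version of E(Y | G); the default value 0 is only taken when there is
   none, which does not happen for an integrable Y and a sub-sigma-algebra G. *)
Definition cond_exp (dT : measure_display) (T : measurableType dT)
    (R : realType) (P : probability T R) (G : set_system T) (Y : T -> R) :
    T -> R :=
  xget (fun=> 0) [set Z | is_cond_exp P G Y Z].

(* sigma(X_j, j in u) *)
Definition sigma_RVs (dT : measure_display) (T : measurableType dT)
    (R : realType) (P : probability T R) (d : nat) (X : 'I_d -> {RV P >-> R})
    (u : {set 'I_d}) : set_system T :=
  <<s \bigcup_(j in [set` u]) preimage_set_system setT (X j) measurable >>.

Definition apply_RVs (dT : measure_display) (T : measurableType dT)
    (R : realType) (P : probability T R) (d : nat) (X : 'I_d -> {RV P >-> R})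
    (f : 'cV[R]_d -> R) (w : T) : R :=
  f (\col_j X j w).

(* n is fuel: any n >= #|u| gives the same component, see anovaE. *)
Fixpoint anova_rec (dT : measure_display) (T : measurableType dT)
    (R : realType) (P : probability T R) (d : nat) (X : 'I_d -> {RV P >-> R})
    (f : 'cV[R]_d -> R) (n : nat) (u : {set 'I_d}) (w : T) : R :=
  cond_exp P (sigma_RVs X u) (apply_RVs X f) w -
  (if n is m.+1 then
     \sum_(v : {set 'I_d} | v \proper u) anova_rec X f m v w
   else 0).

(* The ANOVA component f_u, as the random variable f_u(X). *)
Definition anova (dT : measure_display) (T : measurableType dT)
    (R : realType) (P : probability T R) (d : nat) (X : 'I_d -> {RV P >-> R})
    (f : 'cV[R]_d -> R) (u : {set 'I_d}) : T -> R :=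
  anova_rec X f #|u| u.

Lemma anova_rec_card (dT : measure_display) (T : measurableType dT)
    (R : realType) (P : probability T R) (d : nat) (X : 'I_d -> {RV P >-> R})
    (f : 'cV[R]_d -> R) (n : nat) (u : {set 'I_d}) (w : T) :
  (#|u| <= n)%N -> anova_rec X f n u w = anova X f u w.
Proof.
rewrite /anova; elim: n {-2}n (leqnn n) u => [|N IH] [|n] // nN u un.
- by have -> : #|u| = 0%N by apply/eqP; rewrite -leqn0.
- by have -> : #|u| = 0%N by apply/eqP; rewrite -leqn0.
case E : #|u| => [|m] /=.
  congr (_ - _); rewrite big_pred0// => v; apply/negP => /proper_card.
  by rewrite E.
congr (_ - _); apply: eq_bigr => v /proper_card; rewrite E ltnS => vm.
have mn : (m <= n)%N by rewrite -ltnS -E.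
by rewrite !IH// ?(leq_trans vm)// (leq_trans mn).
Qed.

Lemma anovaE (dT : measure_display) (T : measurableType dT)
    (R : realType) (P : probability T R) (d : nat) (X : 'I_d -> {RV P >-> R})
    (f : 'cV[R]_d -> R) (u : {set 'I_d}) (w : T) :
  anova X f u w = cond_exp P (sigma_RVs X u) (apply_RVs X f) w -
                  \sum_(v : {set 'I_d} | v \proper u) anova X f v w.
Proof.
rewrite -(@anova_rec_card _ _ _ _ _ _ _ #|u|.+1)//=.
congr (_ - _); apply: eq_bigr => v /proper_card vu.
by rewrite anova_rec_card// ltnW.
Qed.

Definition anova_variance (dT : measure_display) (T : measurableType dT)
    (R : realType) (P : probability T R) (d : nat) (X : 'I_d -> {RV P >-> R})
    (f : 'cV[R]_d -> R) (u : {set 'I_d}) : R :=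
  if u == finset.set0 then 0 else fine ('E_P[fun w => (anova X f u w ^+ 2)%R])%E.

Definition mean_dimension (dT : measure_display) (T : measurableType dT)
    (R : realType) (P : probability T R) (d : nat) (X : 'I_d -> {RV P >-> R})
    (f : 'cV[R]_d -> R) : R :=
  (\sum_(u : {set 'I_d}) #|u|%:R * anova_variance X f u) /
  (\sum_(u : {set 'I_d}) anova_variance X f u).

(* Main.v *)
(** Let [K_u h (x)] be the mean of [h] when the coordinates of [x] outside [u]
are replaced by independent standard Gaussians.  Then [K_u f (X)] is a version
of [E(f(X) | X_u)] and [K_u (K_v f) = K_(u :&: v) f], so that
[E(K_u f * K_v f) = M (u :&: v)] with [M w = E(f * K_w f)].  Hence the ANOVA
components are orthogonal and the variances of the [f_v] with [v] included in
[u] add up to [M u]; counting each [u] once for each of its elements gives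
[nu(f) = (\sum_j (M T - M (T :\ j))) / (M T - M set0)], with [T] the set of all
coordinates.

For the half-space, the law of [theta^T x] is standard normal, which makes the
denominator [Phi(t) Phi(-t)].  Conditionally on the other coordinates, of which
[Y] is the linear combination, [f] is Bernoulli of parameter [q = Phi(- r)]
with [r = (t - Y) / |theta_j|], so [M T - M (T :\ j) = E(q (1 - q))].  The bound
[q (1 - q) >= e^(-1 - r^2) / (2 sqrt(2 pi))] reduces this to the mean of a
Gaussian kernel in [Y], which is explicit. *)

Require Import Defs.
From HB Require Import structures.
From mathcomp Require Import all_boot all_order all_algebra.
From mathcomp Require Import all_classical all_reals all_analysis.
From mathcomp Require Import measurable_realfun ring lra.

Import Order.TTheory GRing.Theory Num.Theory.
Import numFieldNormedType.Exports.

Set Implicit Arguments.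
Unset Strict Implicit.
Unset Printing Implicit Defensive.

Local Open Scope classical_set_scope.
Local Open Scope ring_scope.

(** * Independent resampling of coordinates *)

Section mix.
Context {d0 : measure_display} {S : measurableType d0} {n : nat}.
Local Notation V := (n.-tuple S).

Definition mix (u : {set 'I_n}) (x y : V) : V :=
  [tuple if j \in u then tnth x j else tnth y j | j < n].

Lemma tnth_mix u x y j :
  tnth (mix u x y) j = if j \in u then tnth x j else tnth y j.
Proof. by rewrite tnth_mktuple. Qed.

(** A coordinate of [x] survives both mixings only if it lies in [u] and in [v]. This is the
    pointwise form of the composition rule for conditional means. *)
Lemma mix_mix u v x y z :
  mix v (mix u x y) z = mix (u :&: v)%SET x (mix v y z).
Proof.
apply: eq_from_tnth => j; rewrite !tnth_mix finset.in_setI.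
by case: (j \in u); case: (j \in v).
Qed.

Lemma mixT x y : mix [set: 'I_n]%SET x y = x.
Proof. by apply: eq_from_tnth => j; rewrite tnth_mix finset.in_setT. Qed.

Lemma mix0 x y : mix finset.set0 x y = y.
Proof. by apply: eq_from_tnth => j; rewrite tnth_mix finset.in_set0. Qed.

Lemma mix_mixl u x y z : mix u (mix u x y) z = mix u x z.
Proof. by apply: eq_from_tnth => j; rewrite !tnth_mix; case: (j \in u). Qed.

Lemma measurable_mix u d1 (U : measurableType d1) (f g : U -> V) :
  measurable_fun setT f -> measurable_fun setT g ->
  measurable_fun setT (fun w => mix u (f w) (g w)).
Proof.
move=> mf mg; apply/measurable_fun_tnthP => j.
rewrite (_ : _ \o _ = if j \in u then (@tnth _ S ^~ j) \o f
                      else (@tnth _ S ^~ j) \o g); last first.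
  by apply/funext => w /=; rewrite tnth_mix; case: ifP.
by case: ifP => _; apply: measurableT_comp => //; exact: measurable_tnth.
Qed.

Definition box (B : 'I_n -> set S) : set V :=
  [set x | forall j, B j (tnth x j)].

Definition boxes : set_system V :=
  [set box B | B in [set B | forall j, measurable (B j)]].

Lemma measurable_box (B : 'I_n -> set S) :
  (forall j, measurable (B j)) -> measurable (box B).
Proof.
move=> mB; rewrite (_ : box B = \bigcap_(j in [set: 'I_n])
  ((@tnth _ S ^~ j) @^-1` B j)); last first.
  by apply/seteqP; split=> x /= Bx => [j _|j]; exact: Bx.
apply: fin_bigcap_measurable => // j _.
by rewrite -[X in measurable X]setTI; exact: measurable_tnth.
Qed.

Lemma measurable_boxes : (@measurable _ V) = <<s boxes >>.
Proof.
apply/seteqP; split; last first.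
  apply: smallest_sub; first exact: sigma_algebra_measurable.
  by move=> _ [B mB <-]; exact: measurable_box.
apply: smallest_sub; first exact: smallest_sigma_algebra.
move=> A; rewrite -bigcup_seq => -[j _ [B mB <-]]; rewrite setTI.
apply: sub_sigma_algebra; exists (fun i => if i == j then B else setT).
  by move=> i /=; case: ifP.
apply/seteqP; split=> x /=; first by move/(_ j); rewrite eqxx.
by move=> Bx i; case: eqP => // ->.
Qed.

Lemma setI_boxes : setI_closed boxes.
Proof.
move=> _ _ [B mB <-] [C mC <-]; exists (fun j => B j `&` C j).
  by move=> j; exact: measurableI.
apply/seteqP; split=> x /=; first by move=> BC; split=> j; case: (BC j).
by move=> [Bx Cx] j; split.
Qed.

(** Boxes are stable under intersection, include the whole space and generate the product
    sigma-algebra, so the uniqueness theorem for measures applies. *)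
Lemma box_measure_unique {R : realType} (m1 : probability V R)
    (m2 : {measure set V -> \bar R}) :
  (forall B, (forall j, measurable (B j)) -> m1 (box B) = m2 (box B)) ->
  forall A, measurable A -> m1 A = m2 A.
Proof.
move=> m12 A mA.
apply: (measure_unique boxes (fun=> setT)) => //.
- exact: measurable_boxes.
- exact: setI_boxes.
- by move=> _; exists (fun=> setT) => //; apply/seteqP; split.
- by rewrite bigcup_const.
- by move=> _ [B mB <-]; exact: m12.
- by move=> _; apply: (@le_lt_trans _ _ 1%E); [exact: probability_le1|exact: ltry].
Qed.

End mix.

Lemma integral_cst_probability d (T : measurableType d) (R : realType)
    (P : probability T R) (c : \bar R) : (\int[P]_x c = c)%E.
Proof.
rewrite integral_cst// -[RHS]mule1; congr (_ * _)%E.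
exact: probability_setT.
Qed.

(** * Conditional means under a product measure *)

Section conditional_mean.
Context {d0 : measure_display} {S : measurableType d0} {n : nat} {R : realType}.
Local Notation V := (n.-tuple S).
Variables (mu : probability V R) (nu : 'I_n -> set S -> \bar R).
Hypothesis nuT : forall j, nu j setT = 1%E.
Hypothesis mu_box : forall B, (forall j, measurable (B j)) ->
  mu (box B) = (\prod_(j < n) nu j (B j))%E.
Local Open Scope ereal_scope.


(** Mixing two independent draws from the product measure [mu] gives a draw from [mu]. On boxes: the
    preimage of a box under [mix] is a product of two boxes, and for each [j] one of them
    contributes [nu j (B j)] and the other [nu j setT = 1]. Tonelli then separates the two draws. *)
Lemma integral_mix u (h : V -> \bar R) :
  measurable_fun setT h -> (forall x, 0 <= h x) ->
  \int[mu]_x \int[mu]_y h (mix u x y) = \int[mu]_x h x.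
Proof.
move=> mh h0.
have mm : measurable_fun setT (fun p : V * V => mix u p.1 p.2).
  exact: measurable_mix.
pose mixm : {mfun (V * V)%type >-> V} := HB.pack (fun p : V * V => mix u p.1 p.2)
  (isMeasurableFun.Build _ _ _ _ _ mm).
have mhm : measurable_fun setT (h \o mixm) by exact: measurableT_comp.
have boxE (B : 'I_n -> set S) : mixm @^-1` box B =
    box (fun j => if j \in u then B j else setT) `*`
    box (fun j => if j \in u then setT else B j).
  apply/seteqP; split=> [[x y] /= Bx|[x y] /= [Bx By] j].
    by split=> j; have := Bx j; rewrite tnth_mix; case: ifP.
  by rewrite tnth_mix; have := Bx j; have := By j; case: ifP.
have muE A : measurable A -> mu A = pushforward (mu \x mu) mixm A.
  move=> mA; apply: box_measure_unique => //.
  move=> B mB; rewrite mu_box//; transitivity ((mu \x mu)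
    (box (fun j => if j \in u then B j else setT) `*`
     box (fun j => if j \in u then setT else B j)));
    last by rewrite -boxE.
  transitivity (mu (box (fun j => if j \in u then B j else setT)) *
                mu (box (fun j => if j \in u then setT else B j))); last first.
    by apply/esym/product_measure1E; apply: measurable_box => j; case: ifP.
  rewrite !mu_box; last 2 first.
  - by move=> j; case: ifP.
  - by move=> j; case: ifP.
  rewrite -big_split/=; apply: eq_bigr => j _.
  by case: ifP => _; rewrite nuT ?mule1 ?mul1e.
rewrite -(@fubini_tonelli1 _ _ _ _ _ mu mu (h \o mixm))//;
  last by move=> p; exact: h0.
rewrite -(@ge0_integral_pushforward _ _ _ _ _ mixm _ (mu \x mu) setT h)//.
by apply: eq_measure_integral => A mA _; exact/esym/muE.
Qed.

(** The operator [K_u] of the overview. Extended real values allow Tonelli's theorem for any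
    nonnegative measurable [h]. *)
Definition cmean (u : {set 'I_n}) (h : V -> \bar R) (x : V) : \bar R :=
  \int[mu]_y h (mix u x y).

Lemma cmean_ge0 u h x : (forall x, 0 <= h x) -> 0 <= cmean u h x.
Proof. by move=> h0; exact: integral_ge0. Qed.

Lemma cmean_le1 u h x : measurable_fun setT h ->
  (forall x, 0 <= h x) -> (forall x, h x <= 1) -> cmean u h x <= 1.
Proof.
move=> mh h0 h1; rewrite -[leRHS](integral_cst_probability mu).
apply: ge0_le_integral => //.
by apply: measurableT_comp => //; exact: measurable_mix.
Qed.

Lemma measurable_cmean u h : measurable_fun setT h -> (forall x, 0 <= h x) ->
  measurable_fun setT (cmean u h).
Proof.
move=> mh h0.
apply: (@measurable_fun_fubini_tonelli_F _ _ _ _ _ mu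
         (fun p => h (mix u p.1 p.2))) => //.
by apply: measurableT_comp => //; exact: measurable_mix.
Qed.

Lemma cmean_mixl u h x y : cmean u h (mix u x y) = cmean u h x.
Proof. by apply: eq_integral => z _; rewrite mix_mixl. Qed.

Lemma cmean_cmean u v h : measurable_fun setT h -> (forall x, 0 <= h x) ->
  cmean u (cmean v h) = cmean (u :&: v)%SET h.
Proof.
move=> mh h0; apply/funext => x; rewrite /cmean.
under eq_integral do under eq_integral do rewrite mix_mix.
rewrite (@integral_mix v (fun z => h (mix (u :&: v)%SET x z)))//.
by apply: measurableT_comp => //; exact: measurable_mix.
Qed.

Lemma cmeanT h : cmean [set: 'I_n]%SET h = h.
Proof.
apply/funext => x; rewrite /cmean.
under eq_integral do rewrite mixT.
by rewrite integral_cst_probability.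
Qed.

Lemma cmean0 h x : cmean finset.set0 h x = \int[mu]_y h y.
Proof. by apply: eq_integral => y _; rewrite mix0. Qed.

(** The averaging property of a conditional expectation: resampling outside [u] leaves the weight
    [k] unchanged, so it comes out of the inner integral. *)
Lemma integral_cmeanM u h k : measurable_fun setT h -> (forall x, 0 <= h x) ->
  measurable_fun setT k -> (forall x, 0 <= k x) ->
  (forall x y, k (mix u x y) = k x) ->
  \int[mu]_x (cmean u h x * k x) = \int[mu]_x (h x * k x).
Proof.
move=> mh h0 mk k0 kE.
rewrite -(@integral_mix u (fun x => h x * k x)); last 2 first.
- exact: emeasurable_funM.
- by move=> x; rewrite mule_ge0.
apply: eq_integral => x _.
under [RHS]eq_integral do rewrite kE.
rewrite ge0_integralZr//.
by apply: measurableT_comp => //; exact: measurable_mix.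
Qed.

(** The quantity [M u] of the overview. *)
Definition cmoment (h : V -> \bar R) (u : {set 'I_n}) : \bar R :=
  \int[mu]_x (h x * cmean u h x).

(** Averaging over [u] is used twice: first with weight [cmean u h], which turns [cmean v h] into
    [cmean (u :&: v) h]; then with this last function as weight, since it too ignores the
    coordinates outside [u]. *)
Lemma integral_cmean_cmean u v h :
  measurable_fun setT h -> (forall x, 0 <= h x) ->
  \int[mu]_x (cmean u h x * cmean v h x) = cmoment h (u :&: v)%SET.
Proof.
move=> mh h0.
under eq_integral do rewrite muleC.
rewrite -(@integral_cmeanM u (cmean v h))//; first last.
- exact: cmean_mixl.
- by move=> x; exact: cmean_ge0.
- exact: measurable_cmean.
- by move=> x; exact: cmean_ge0.
- exact: measurable_cmean.
rewrite cmean_cmean//.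
under eq_integral do rewrite muleC.
rewrite (@integral_cmeanM u)//.
- exact: measurable_cmean.
- by move=> x; exact: cmean_ge0.
- move=> x y; apply: eq_integral => z _; congr h.
  by apply: eq_from_tnth => j; rewrite !tnth_mix finset.in_setI; case: (j \in u).
Qed.

End conditional_mean.

(** * ANOVA components as a Gram matrix *)

Section gram_matrix.
Variables (R : nzRingType) (I : finType).
Variables (p : {set I} -> {set I} -> R) (M : {set I} -> R).
Hypothesis p_sym : forall u v, p u v = p v u.
Hypothesis sum_p : forall u v : {set I},
  \sum_(u' : {set I} | u' \subset u) \sum_(v' : {set I} | v' \subset v) p u' v'
  = M (u :&: v)%SET.

(** Here [p u v] stands for the inner product of two components, and [q u v] for that of a component
    with the partial sum over the subsets of [v]. Strong induction on [u] gives [q u v = 0] unless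
    [u] is included in [v]; induction on [v] then gives the same for [p], and symmetry leaves only
    [u = v]. *)
Lemma gram_orthogonal (u v : {set I}) : u != v -> p u v = 0.
Proof.
pose q (u v : {set I}) := \sum_(v' : {set I} | v' \subset v) p u v'.
have split_sum (F : {set I} -> R) (w : {set I}) :
    \sum_(w' : {set I} | w' \subset w) F w' =
    F w + \sum_(w' : {set I} | w' \proper w) F w'.
  rewrite (bigD1 w)//=; congr (_ + _); apply: eq_bigl => w'.
  by rewrite finset.properEneq andbC.
have q0 : forall u v : {set I}, ~~ (u \subset v) -> q u v = 0.
  move=> {}u {}v; elim: {u}_.+1 {-2}u (ltnSn #|u|) => // m IH u um uv.
  have E : q u v + \sum_(u' : {set I} | u' \proper u) q u' v = M (u :&: v)%SET.
    by rewrite -sum_p [RHS]split_sum.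
  suff S : \sum_(u' : {set I} | u' \proper u) q u' v = M (u :&: v)%SET.
    by move: E; rewrite S => /(canRL (addrK _)); rewrite subrr.
  rewrite (bigID (fun u' : {set I} => u' \subset v))/=.
  rewrite [X in _ + X]big1 ?addr0; last first.
    move=> u' /andP[u'u u'v]; apply: IH => //.
    by rewrite (leq_trans (fintype.proper_card u'u)).
  (* As [u] is not included in [v], its proper subsets included in [v] are exactly the subsets of
     [u :&: v], whose terms already add up to [M (u :&: v)]. *)
  rewrite -[in RHS](finset.setIid v) finset.setIA -sum_p; apply: eq_bigl => u'.
  rewrite finset.subsetI finset.properEneq.
  case u'v: (u' \subset v); rewrite ?andbF// !andbT.
  by rewrite andb_idl// => _; apply: contraNneq uv => <-.
have p0 : forall u v : {set I}, ~~ (u \subset v) -> p u v = 0.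
  move=> {}u {}v; elim: {v}_.+1 {-2}v (ltnSn #|v|) => // m IH v vm uv.
  have := q0 _ _ uv; rewrite /q split_sum big1 ?addr0// => v' v'v.
  apply: IH; first by rewrite (leq_trans (fintype.proper_card v'v)).
  by apply: contra uv => /fintype.subset_trans; apply; exact: fintype.proper_sub.
move=> uv; have [/p0//|] := boolP (~~ (u \subset v)); rewrite negbK => u_v.
rewrite p_sym p0//; apply: contra uv => v_u.
by rewrite finset.eqEsubset u_v.
Qed.

Lemma gram_diagonal (v : {set I}) : \sum_(u : {set I} | u \subset v) p u u = M v.
Proof.
rewrite -[in RHS](finset.setIid v) -sum_p; apply: eq_bigr => u uv.
rewrite (bigD1 u)//= big1 ?addr0// => w /andP[_ wu].
by rewrite gram_orthogonal// eq_sym.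
Qed.

(** After exchanging the sums, the sets containing [j] are all sets except the subsets of
    [[set~ j]], and [gram_diagonal] evaluates both families. *)
Lemma gram_sum_card : \sum_(u : {set I}) #|u|%:R * p u u =
  \sum_(j : I) (M [set: I]%SET - M [set~ j]%SET).
Proof.
transitivity (\sum_(u : {set I}) \sum_(j in u) p u u).
  by apply: eq_bigr => u _; rewrite sumr_const mulr_natl.
rewrite (exchange_big_dep xpredT)//=; apply: eq_bigr => j _.
rewrite -!gram_diagonal.
rewrite [X in _ = X - _](eq_bigl xpredT); last by move=> u; rewrite finset.subsetT.
rewrite [X in _ = X - _](bigID (fun u : {set I} => j \in u))/= -addrA.
rewrite [X in _ = _ + (X - _)](_ : _ =
  \sum_(u : {set I} | u \subset [set~ j]%SET) p u u).
  by rewrite subrr addr0.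
by apply: eq_bigl => u; rewrite finset.subsetC finset.sub1set finset.in_setC.
Qed.

End gram_matrix.

(** * One-dimensional Gaussian estimates *)

Section normal.
Context {R : realType}.
Local Notation mu := (@lebesgue_measure R).
Implicit Types (m s c t x y : R).

(** The Radon-Nikodym derivative and [normal_pdf] have the same integral over every measurable set,
    hence agree almost everywhere. *)
Lemma integral_normal_prob m s (f : R -> \bar R) :
  (normal_prob m s).-integrable setT f ->
  (\int[normal_prob m s]_x f x = \int[mu]_x (f x * (normal_pdf m s x)%:E))%E.
Proof.
move=> intf; have mf := measurable_int _ intf.
rewrite -(Radon_Nikodym_change_of_variables (normal_prob_dominates m s))//=.
apply: ae_eq_integral => //.
- apply: emeasurable_funM => //; apply: (measurable_int mu).
  by apply: Radon_Nikodym_integrable; exact: normal_prob_dominates.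
- apply: emeasurable_funM => //=; apply/measurableT_comp => //=.
  exact: measurable_normal_pdf.
- apply: ae_eqe_mul2l => /=.
  rewrite Radon_NikodymE//=; first exact: normal_prob_dominates.
  move=> dom; case: cid => /= h [h1 h2 h3].
  apply: integral_ae_eq => //=.
  + by apply/measurableT_comp =>//; exact: measurable_normal_pdf.
  + by move=> E _ mE; rewrite -h3.
Qed.

Lemma normal_pdfEexp m s x : s != 0 -> normal_pdf m s x =
  normal_peak s * expR (- (x - m) ^+ 2 / (s ^+ 2 *+ 2)).
Proof. by move=> s0; rewrite normal_pdfE. Qed.

Lemma normal_peakE s : normal_peak s = `|s|^-1 * normal_peak 1.
Proof.
rewrite /normal_peak expr1n mul1r -mulrnAr sqrtrM ?sqr_ge0// sqrtr_sqr.
by rewrite invfM.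
Qed.

Lemma normal_pdfN s x : s != 0 -> normal_pdf 0 s (- x) = normal_pdf 0 s x.
Proof. by move=> s0; rewrite !normal_pdfEexp// !subr0 sqrrN. Qed.

(** Completing the square in [x]. In Bayesian terms, likelihood times prior is the marginal density
    at [c], of variance [q], times the posterior density of [x]. *)
Lemma gaussian_completion (a tau c x : R) (q := tau ^+ 2 + a ^+ 2) : 0 < tau ->
  normal_pdf 0 tau (c - a * x) * normal_pdf 0 1 x =
  normal_pdf 0 (Num.sqrt q) c * normal_pdf (c * a / q) (tau / Num.sqrt q) x.
Proof.
move=> tau0.
have q0 : 0 < q by rewrite ltr_wpDr ?sqr_ge0// exprn_gt0.
have sq0 : 0 < Num.sqrt q by rewrite sqrtr_gt0.
have s0 : 0 < tau / Num.sqrt q by rewrite divr_gt0.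
rewrite (@normal_pdfEexp 0 tau) ?gt_eqF// (@normal_pdfEexp 0 1) ?oner_eq0//.
rewrite (@normal_pdfEexp 0 (Num.sqrt q)) ?gt_eqF//.
rewrite (@normal_pdfEexp _ (tau / Num.sqrt q)) ?gt_eqF//.
rewrite [LHS]mulrACA [RHS]mulrACA -!expRD; congr (_ * expR _).
  rewrite (normal_peakE tau) (normal_peakE (Num.sqrt q)).
  rewrite (normal_peakE (tau / Num.sqrt q)) !gtr0_norm//.
  move: (normal_peak 1) => p; field.
  by rewrite !gt_eqF.
rewrite expr_div_n sqr_sqrtr ?ltW// /q !subr0 expr1n; field.
by rewrite (gt_eqF tau0) (gt_eqF q0).
Qed.

(** By [gaussian_completion], only a density in [x] of total mass 1 is left to integrate. *)
Lemma gaussian_convolution (a tau c : R) : 0 < tau ->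
  (\int[normal_prob 0 1]_x (normal_pdf 0 tau (c - a * x))%:E =
   (normal_pdf 0 (Num.sqrt (tau ^+ 2 + a ^+ 2)) c)%:E)%E.
Proof.
move=> tau0.
have mh : measurable_fun setT (fun x => normal_pdf 0 tau (c - a * x)).
  apply: (measurableT_comp (measurable_normal_pdf 0 tau)) => //.
  by apply: measurable_funB => //; exact: measurable_funM.
(* Integrability: the kernel is bounded by its peak and the measure is a probability. *)
rewrite integral_normal_prob; last first.
  apply/integrableP; split; first exact/measurable_EFinP.
  apply: (@le_lt_trans _ _ (\int[normal_prob 0 1]_x (cst (normal_peak tau)%:E x))%E).
    apply: ge0_le_integral => //.
    - by apply/measurable_EFinP/measurableT_comp.
    - move=> x _; rewrite /= lee_fin ger0_norm ?normal_pdf_ge0//.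
      by rewrite normal_pdf_ub// gt_eqF.
  by rewrite integral_cst_probability ltry.
pose q := tau ^+ 2 + a ^+ 2.
have q0 : 0 < q by rewrite ltr_wpDr ?sqr_ge0// exprn_gt0.
have sq0 : 0 < Num.sqrt q by rewrite sqrtr_gt0.
pose s := tau / Num.sqrt q.
have s0 : 0 < s by rewrite divr_gt0.
transitivity (\int[mu]_x ((normal_pdf 0 (Num.sqrt q) c)%:E *
   (normal_pdf (c * a / q) s x)%:E))%E.
  by apply: eq_integral => x _; rewrite -!EFinM gaussian_completion.
rewrite ge0_integralZl//; first by rewrite integral_normal_pdf mule1.
- by apply/measurable_EFinP; exact: measurable_normal_pdf.
- by move=> x _; rewrite lee_fin normal_pdf_ge0.
- by rewrite lee_fin normal_pdf_ge0.
Qed.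

Lemma normal_prob_oppr (A : set R) : measurable A ->
  normal_prob 0 1 ((fun x => - x) @^-1` A) = normal_prob 0 1 A.
Proof.
move=> mA; rewrite /normal_prob.
rewrite [RHS](eq_measure_integral
  (pushforward mu (-%R : _ -> measurableTypeR R))); last first.
  by move=> B mB _; exact/esym/lebesgue_measureN.
rewrite ge0_integral_pushforward//.
- apply: eq_integral => x _; congr EFin => /=.
  by rewrite normal_pdfN ?oner_eq0.
- by apply/measurable_funTS/measurable_EFinP; exact: measurable_normal_pdf.
- by move=> x _; rewrite lee_fin normal_pdf_ge0.
Qed.

End normal.

(** * The Gaussian tail and its variance bound *)

Section tail.
Context {R : realType}.
Local Notation mu := (@lebesgue_measure R).
Local Notation N := (@normal_prob R 0 1).
Implicit Types (a b s c t x y r : R).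

Definition gtail r : R := fine (N `]r, +oo[).

Lemma normal_prob_gt r : N `]r, +oo[ = (gtail r)%:E.
Proof. by rewrite /gtail fineK// fin_num_measure. Qed.

Lemma gtail_ge0 r : 0 <= gtail r.
Proof. by rewrite /gtail fine_ge0. Qed.

Lemma normal_prob_le r : N `]-oo, r] = (1 - gtail r)%:E.
Proof.
rewrite -setCitvr probability_setC//.
by rewrite EFinB -normal_prob_gt.
Qed.

Lemma gtail_le1 r : gtail r <= 1.
Proof. by rewrite -lee_fin -normal_prob_gt probability_le1. Qed.

Lemma normal_prob_set1 r : N [set r] = 0%E.
Proof.
have /null_content_dominatesP := @normal_prob_dominates R 0 1.
by apply => //; exact: lebesgue_measure_set1.
Qed.

(** Reflection maps []-r, +oo[] to []-oo, r[], which differs from the complement of []r, +oo[] by a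
    null point. *)
Lemma gtailN r : gtail (- r) = 1 - gtail r.
Proof.
apply: EFin_inj; rewrite -normal_prob_gt -normal_prob_le.
rewrite -normal_prob_oppr//.
rewrite (_ : _ @^-1` _ = `]-oo, r[%classic); last first.
  by apply/seteqP; split=> x /=; rewrite !in_itv/= andbT ltrN2.
rewrite -(@setUitv1 _ _ -oo%O r true)// measureU//; last first.
  by apply/seteqP; split=> x //= []; rewrite in_itv/= => /[swap] ->; rewrite ltxx.
by rewrite [X in (_ + X)%E](normal_prob_set1 r) adde0.
Qed.

Lemma gtail_nincr r s : r <= s -> gtail s <= gtail r.
Proof.
move=> rs; rewrite -lee_fin -!normal_prob_gt le_measure ?inE//.
by apply: subset_itvr; rewrite bnd_simp.
Qed.

Lemma Phi_gtail r : Phi r = 1 - gtail r.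
Proof. by rewrite /Phi normal_prob_le. Qed.

Lemma PhiN_gtail r : Phi (- r) = gtail r.
Proof. by rewrite Phi_gtail gtailN subKr. Qed.

(** The tail contains []r, r + 1]], an interval of length 1 on which the density is at least its
    value at [r + 1]. *)
Lemma gtail_lb r : 0 <= r -> normal_peak 1 * expR (- (r + 1) ^+ 2 / 2) <= gtail r.
Proof.
move=> r0; rewrite -lee_fin -normal_prob_gt.
set k := (X in (X%:E <= _)%E).
apply: (@le_trans _ _ (N `]r, r + 1])); last first.
  by rewrite le_measure ?inE//; apply: subset_itvl; rewrite bnd_simp.
apply: (@le_trans _ _ (\int[mu]_(x in `]r, (r + 1)%R]) (cst k%:E x))%E).
  rewrite integral_cst// [X in (_ * X)%E](_ : _ = 1%E) ?mule1//.
  rewrite [LHS]lebesgue_measure_itv/= lte_fin ltrDl ltr01.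
  by rewrite -EFinD addrAC subrr add0r.
apply: ge0_le_integral => //.
- by move=> x _; rewrite lee_fin mulr_ge0 ?normal_peak_ge0 ?expR_ge0.
- by apply/measurable_funTS/measurable_EFinP; exact: measurable_normal_pdf.
- move=> x; rewrite /= in_itv/= => /andP[rx xr].
  rewrite lee_fin normal_pdfEexp ?oner_eq0// /k ler_wpM2l ?normal_peak_ge0//.
  rewrite ler_expR subr0 expr1n ler_pM2r ?invr_gt0// lerN2.
  by rewrite ler_sqr ?nnegrE; lra.
Qed.

(** Both sides are even in [r], so [r >= 0] may be assumed. Then [1 - gtail r >= 1/2], and
    [gtail_lb] bounds the other factor because [(r + 1)^2 / 2 <= 1 + r^2], that is
    [(r - 1)^2 >= 0]. *)
Lemma gtail_variance_lb r :
  expR (- 1) / 2 * normal_peak 1 * expR (- r ^+ 2) <= gtail r * (1 - gtail r).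
Proof.
wlog r0 : r / 0 <= r.
  move=> H; have [|r0] := leP 0 r; first exact: H.
  have := H (- r); rewrite oppr_ge0 gtailN sqrrN subKr => /(_ (ltW r0)).
  by rewrite [gtail r * _]mulrC.
have half : 2^-1 <= 1 - gtail r.
  have := gtailN 0; rewrite oppr0 => h.
  by have := gtail_nincr r0; lra.
rewrite [leRHS]mulrC (_ : expR _ / 2 * _ * _ =
   2^-1 * (normal_peak 1 * expR (- 1 - r ^+ 2))); last by rewrite expRD; ring.
apply: ler_pM => //; first by rewrite mulr_ge0 ?normal_peak_ge0 ?expR_ge0.
apply: le_trans (gtail_lb r0); rewrite ler_wpM2l ?normal_peak_ge0//.
rewrite ler_expR.
have := sqr_ge0 (r - 1); nra.
Qed.

(** The substitution [u = b x + y]. It makes the dependence on [y] a Gaussian kernel, the form that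
    [integral_smoothing] can average. *)
Lemma gtail_shift b t y : 0 < b ->
  ((gtail ((t - y) / b))%:E =
   \int[mu]_(u in `]t, +oo[) (normal_pdf 0 b (u - y))%:E)%E.
Proof.
move=> b0.
pose F x := b * x + y.
have dF (x : R) : is_derive x 1 F b.
  rewrite /F; have : is_derive x 1 (fun x => b * x + y) (b *: 1 + 0).
    by apply: is_deriveD.
  by rewrite addr0 /GRing.scale/= mulr1.
have dF' x : derivable F x 1 by exact: ex_derive.
have F' : F^`()%classic = cst b.
  by apply/funext => x; rewrite derive1E derive_val.
have cF : continuous F.
  move=> x; apply: differentiable_continuous; apply/derivable1_diffP. exact: dF'.
have Ft : F ((t - y) / b) = t by rewrite /F mulrC divfK ?gt_eqF// subrK.
have cG : continuous ((fun u => normal_pdf 0 b (u - y)) : R -> R).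
  move=> u; apply: (@continuous_comp _ _ _ (fun u => u - y) (normal_pdf 0 b)).
    by apply: cvgB; [exact: cvg_id|exact: cvg_cst].
  by apply: continuous_normal_pdf; rewrite gt_eqF.
rewrite integral_itv_obnd_cbnd; last first.
  by apply/measurable_EFinP/measurable_funTS; exact: continuous_measurable_fun cG.
rewrite -[in RHS]Ft.
rewrite (@increasing_ge0_integration_by_substitutiony R F); first last.
- by move=> x _; exact: normal_pdf_ge0.
- by apply: continuous_subspaceT.
- apply/cvgryPge => A; near=> x.
  rewrite /F -lerBlDr -ler_pdivrMl//.
- split=> [x _|]; first exact: dF'.
  by apply: cvg_at_right_filter; exact: cF.
- by rewrite F'; exact: is_cvg_cst.
- by rewrite F'; exact: is_cvg_cst.
- by rewrite F' => x _; exact: cvg_cst.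
- by move=> u v _ _ uv; rewrite /F ltrD2r ltr_pM2l.
rewrite -normal_prob_gt /normal_prob integral_itv_obnd_cbnd; last first.
  by apply/measurable_funTS/measurable_EFinP; exact: measurable_normal_pdf.
apply: eq_integral => x _; congr EFin.
rewrite /= fctE/= F' /= /F addrK !normal_pdfEexp ?gt_eqF// (normal_peakE b).
rewrite gtr0_norm// !subr0 [RHS]mulrC !mulrA divff ?gt_eqF// mul1r.
by congr (_ * expR _); field; rewrite gt_eqF.
Unshelve. all: end_near. Qed.

Lemma normal_prob_affine b t y : b != 0 ->
  N [set x | t < y + b * x] = (gtail ((t - y) / `|b|))%:E.
Proof.
have H c : 0 < c -> [set x | t < y + c * x] = `](t - y) / c, +oo[%classic.
  move=> c0; apply/seteqP; split=> x /=; rewrite in_itv/= andbT;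
    by rewrite ltr_pdivrMr// ltrBlDl [x * _]mulrC.
move=> b0; have [bn|bp] := ltP b 0; last first.
  rewrite ger0_norm// -normal_prob_gt H//.
  by rewrite lt_neqAle eq_sym b0.
rewrite ltr0_norm// -normal_prob_gt -H ?oppr_gt0//.
rewrite -[RHS]normal_prob_oppr//; last first.
  by rewrite H ?oppr_gt0.
by congr (N _); apply/seteqP; split=> x /=; rewrite mulrNN.
Qed.

End tail.

(** * Moments of a half-space *)

Section halfspace.
Context {R : realType} {n : nat}.
Local Notation V := (n.-tuple R).
Local Notation leb := (@lebesgue_measure R).
Variables (mu : probability V R) (theta : 'I_n -> R).
Hypothesis mu_box : forall B, (forall j, measurable (B j)) ->
  mu (box B) = (\prod_(j < n) normal_prob 0 1 (B j))%E.

Let nu (j : 'I_n) : set R -> \bar R := normal_prob 0 1.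

Let nuT j : nu j setT = 1%E. Proof. exact: probability_setT. Qed.

Let partial (r : seq 'I_n) (x : V) : R := \sum_(i <- r) theta i * tnth x i.

Let measurable_partial r : measurable_fun setT (partial r).
Proof.
apply: measurable_sum => i; apply: measurable_funM => //.
exact: measurable_tnth.
Qed.

Lemma integral_marginal j (g : R -> \bar R) :
  measurable_fun setT g -> (forall x, 0 <= g x)%E ->
  (\int[mu]_x g (tnth x j) = \int[normal_prob 0 1]_z g z)%E.
Proof.
move=> mg g0.
have mt : measurable_fun setT ((fun x => tnth x j) : V -> measurableTypeR R).
  exact: measurable_tnth.
have := @ge0_integral_pushforward _ _ _ _ _ _ mt mu setT g measurableT mg
  (fun x _ => g0 x).
rewrite preimage_setT => <-.
apply: eq_measure_integral => A mA _.
pose B i := if i == j then A else setT.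
transitivity (mu (box B)).
  congr (mu _); apply/seteqP; split=> x /=.
    by move=> Ax i; rewrite /B; case: eqP => // ->.
  by move/(_ j); rewrite /B eqxx.
rewrite mu_box; last by move=> i; rewrite /B; case: ifP.
rewrite (bigD1 j)//= /B eqxx big1 ?mule1// => i /negbTE ->.
exact: probability_setT.
Qed.

Lemma integral_resample j (h : V -> \bar R) :
  measurable_fun setT h -> (forall x, 0 <= h x)%E ->
  (\int[mu]_x h x = \int[mu]_x cmean mu [set~ j]%SET h x)%E.
Proof. by move=> mh h0; rewrite (integral_mix (nu := nu) nuT). Qed.

(** Since [j] is not in [r], resampling coordinate [j] alone fixes the partial sum and replaces the
    second argument of [g] by a fresh standard Gaussian. *)
Lemma cmean_coord j (r : seq 'I_n) (g : R -> R -> \bar R) (x : V) :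
  j \notin r -> measurable_fun setT (g (partial r x)) ->
  (forall a b, 0 <= g a b)%E ->
  cmean mu [set~ j]%SET (fun x => g (partial r x) (tnth x j)) x =
  (\int[normal_prob 0 1]_z g (partial r x) z)%E.
Proof.
move=> jr mg g0; rewrite -(@integral_marginal j)//.
apply: eq_integral => y _; congr g.
  apply: eq_big_seq => i ir; rewrite tnth_mix finset.in_setC1.
  by rewrite (_ : i != j)//; apply: contraNneq jr => <-.
by rewrite tnth_mix finset.in_setC1 eqxx.
Qed.

(* Each coordinate of the sum convolves the Gaussian kernel with another
   Gaussian, so the variances add up. *)
Lemma integral_smoothing (r : seq 'I_n) tau c : uniq r -> 0 < tau ->
  (\int[mu]_x (normal_pdf 0 tau (c - partial r x))%:E =
   (normal_pdf 0 (Num.sqrt (tau ^+ 2 + \sum_(i <- r) theta i ^+ 2)) c)%:E)%E.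
Proof.
elim: r tau => [|j r IH] tau /=.
  move=> _ tau0; rewrite big_nil addr0 sqrtr_sqr gtr0_norm//.
  under eq_integral do rewrite /partial big_nil subr0.
  by rewrite integral_cst_probability.
move=> /andP[jr ur] tau0.
pose g a b := (normal_pdf 0 tau (c - (a + theta j * b)))%:E.
have gE x : (normal_pdf 0 tau (c - partial (j :: r) x))%:E =
    g (partial r x) (tnth x j).
  by rewrite /g /partial big_cons [theta j * _ + _]addrC.
under eq_integral do rewrite gE.
rewrite (@integral_resample j); last 2 first.
- apply/measurable_EFinP/(measurableT_comp (measurable_normal_pdf 0 tau)) => //.
  apply: measurable_funB => //; apply: measurable_funD => //.
  by apply: measurable_funM => //; exact: measurable_tnth.
- by move=> x; rewrite lee_fin normal_pdf_ge0.
transitivity (\int[mu]_x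
    (normal_pdf 0 (Num.sqrt (tau ^+ 2 + theta j ^+ 2)) (c - partial r x))%:E)%E.
  apply: eq_integral => x _; rewrite cmean_coord//; first last.
  - by move=> a b; rewrite lee_fin normal_pdf_ge0.
  - apply/measurable_EFinP/(measurableT_comp (measurable_normal_pdf 0 tau)) => //.
    apply: measurable_funB => //; apply: measurable_funD => //.
  rewrite -(gaussian_convolution (theta j) (c - partial r x) tau0).
  apply: eq_integral => z _.
  by rewrite /g opprD addrA.
have q0 : 0 < tau ^+ 2 + theta j ^+ 2 by rewrite ltr_wpDr ?sqr_ge0// exprn_gt0.
rewrite IH//; last by rewrite sqrtr_gt0.
by rewrite sqr_sqrtr ?ltW// big_cons addrA.
Qed.

Hypothesis theta_unit : \sum_(i < n) theta i ^+ 2 = 1.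
Variable t : R.

Definition halfspace : set V := [set x | t < \sum_(i < n) theta i * tnth x i].

Let f (x : V) : \bar R := (\1_halfspace x)%:E.

Lemma measurable_halfspace : measurable halfspace.
Proof.
rewrite /halfspace -[X in measurable X]setTI.
have := measurable_partial (index_enum 'I_n) measurableT (measurable_itv `]t, +oo[).
congr (measurable (_ `&` _)); apply/seteqP.
by split=> x /=; rewrite in_itv/= andbT.
Qed.

Let others j := [seq i <- index_enum 'I_n | i != j].

Let othersE j (F : 'I_n -> R) :
  \sum_(i < n) F i = \sum_(i <- others j) F i + F j.
Proof. by rewrite (bigD1 j)//= addrC big_filter. Qed.

Let others_notin j : j \notin others j.
Proof. by rewrite mem_filter eqxx. Qed.

Let uniq_others j : uniq (others j).
Proof. by rewrite filter_uniq// index_enum_uniq. Qed.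

Lemma cmean_halfspace j x : theta j != 0 ->
  cmean mu [set~ j]%SET f x =
  (gtail ((t - partial (others j) x) / `|theta j|))%:E.
Proof.
move=> j0.
pose g a b : \bar R := (\1_[set z | t < a + theta j * z] b)%:E.
have mg a : measurable [set z | t < a + theta j * z].
  rewrite -[X in measurable X]setTI.
  have mh : measurable_fun setT (fun z => a + theta j * z).
    by apply: measurable_funD => //; exact: measurable_funM.
  have := mh measurableT _ (measurable_itv `]t, +oo[).
  congr (measurable (_ `&` _)); apply/seteqP.
  by split=> z /=; rewrite in_itv/= andbT.
have fE : f = (fun x => g (partial (others j) x) (tnth x j)).
  apply/funext => y; rewrite /f /g !indicE; congr (_%:R%:E).
  by congr (nat_of_bool _); apply: asbool_equiv_eq;
    rewrite /halfspace/= (othersE j).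
rewrite fE cmean_coord//.
- rewrite /g integral_indic//.
  transitivity (normal_prob 0 1 [set z | t < partial (others j) x + theta j * z]).
    by congr (normal_prob _ _ _); exact: setIT.
  exact: normal_prob_affine.
- exact: mg.
- by apply/measurable_EFinP; exact: measurable_indic.
- by move=> a b; rewrite lee_fin.
Qed.

Lemma halfspace_exists_coord : exists j, theta j != 0.
Proof.
apply: contrapT => /forallNP h.
have s0 : \sum_(i < n) theta i ^+ 2 = 0.
  by apply: big1 => i _; have /negP/negPn/eqP -> := h i; rewrite expr0n.
by move: theta_unit; rewrite s0 => /esym/eqP; rewrite oner_eq0.
Qed.

(** Smoothing needs a kernel of positive width to start from: a coordinate with [theta j != 0]
    provides one of variance [theta j ^+ 2]. After Tonelli the other coordinates raise the variance
    to 1. *)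
Lemma probability_halfspace : mu halfspace = (gtail t)%:E.
Proof.
have [j j0] := halfspace_exists_coord.
have j0' : 0 < `|theta j| by rewrite normr_gt0.
have fE : (\int[mu]_x f x = mu halfspace)%E.
  by rewrite integral_indic ?setIT//; exact: measurable_halfspace.
rewrite -fE (@integral_resample j); last 2 first.
- by apply/measurable_EFinP/measurable_indic; exact: measurable_halfspace.
- by move=> x; rewrite lee_fin.
under eq_integral do rewrite cmean_halfspace// gtail_shift//.
pose k (x : V) (u : R) : R := normal_pdf 0 `|theta j| (u - partial (others j) x).
transitivity (\int[mu]_x \int[leb]_u ((\1_`]t, +oo[ u)%:E * (k x u)%:E))%E.
  apply: eq_integral => x _; rewrite integral_mkcond.
  apply: eq_integral => u _; rewrite patchE indicE.
  by case: ifP; rewrite ?mul1e ?mul0e.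
have mk : measurable_fun setT (fun p : V * R => k p.1 p.2).
  apply: (measurableT_comp (measurable_normal_pdf 0 `|theta j|)) => //.
  apply: measurable_funB => //.
  by apply: (measurableT_comp (measurable_partial (others j))).
rewrite (@fubini_tonelli _ _ _ _ _ mu leb
   (fun p => (\1_`]t, +oo[ p.2)%:E * (k p.1 p.2)%:E)%E); last 2 first.
- apply: emeasurable_funM; last exact/measurable_EFinP.
  apply/measurable_EFinP; apply: measurableT_comp => //.
- by move=> p; rewrite mule_ge0// lee_fin ?normal_pdf_ge0.
transitivity (\int[leb]_u ((\1_`]t, +oo[ u)%:E * (normal_pdf 0 1 u)%:E))%E.
  apply: eq_integral => u _ /=; rewrite ge0_integralZl//; last 2 first.
  - apply/measurable_EFinP.
    apply: (measurableT_comp (measurable_normal_pdf 0 `|theta j|)) => //.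
    by apply: measurable_funB => //; exact: measurable_partial.
  - by move=> x _; rewrite lee_fin normal_pdf_ge0.
  congr (_ * _)%E; rewrite integral_smoothing//.
  by rewrite real_normK ?num_real// addrC -othersE theta_unit sqrtr1.
rewrite -normal_prob_gt /normal_prob [RHS]integral_mkcond.
apply: eq_integral => u _; rewrite patchE indicE.
by case: ifP; rewrite ?mul1e ?mul0e.
Qed.

Let mf : measurable_fun setT f.
Proof.
by apply/measurable_EFinP; apply: measurable_indic; exact: measurable_halfspace.
Qed.

Let f0 x : (0 <= f x)%E. Proof. by rewrite lee_fin. Qed.

Let f1 x : (f x <= 1)%E.
Proof. by rewrite lee_fin /= indicE; case: (_ \in _). Qed.

Let integral_f : (\int[mu]_x f x = (gtail t)%:E)%E.
Proof.
rewrite -probability_halfspace /f integral_indic//.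
  by congr (mu _); exact: setIT.
exact: measurable_halfspace.
Qed.

Lemma cmoment_halfspaceT : cmoment mu f [set: 'I_n]%SET = (gtail t)%:E.
Proof.
rewrite /cmoment cmeanT -integral_f; apply: eq_integral => x _.
by rewrite /f indicE -EFinM; case: (_ \in _); rewrite ?mulr1 ?mulr0.
Qed.

Lemma cmoment_halfspace0 : cmoment mu f finset.set0 = (gtail t ^+ 2)%:E.
Proof.
rewrite /cmoment; under eq_integral do rewrite cmean0 integral_f.
rewrite ge0_integralZr// ?lee_fin ?gtail_ge0//.
by rewrite integral_f -EFinM.
Qed.

(** Serves for coordinates with zero coefficient and for the finiteness of the moments. *)
Lemma cmoment_halfspace_le u : (cmoment mu f u <= (gtail t)%:E)%E.
Proof.
rewrite -integral_f; apply: ge0_le_integral => //.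
- by move=> x _; rewrite mule_ge0// cmean_ge0.
- by apply: emeasurable_funM => //; exact: measurable_cmean.
- by move=> x _; rewrite -[leRHS]mule1 lee_wpmul2l// cmean_le1.
Qed.

(** With [g] the conditional mean of [f] given the other coordinates, [E f = E g] and the moment is
    [E(g^2)], so the gap is [E(g (1 - g))]. The bound is stated as a sum to avoid subtracting
    extended reals. *)
Lemma cmoment_halfspaceC_neq0 j : theta j != 0 ->
  (cmoment mu f [set~ j]%SET + (expR (- 1) / 2 * (`|theta j| / Num.sqrt 2) *
    normal_pdf 0 (Num.sqrt (1 - theta j ^+ 2 / 2)) t)%:E <= (gtail t)%:E)%E.
Proof.
move=> j0.
pose g x := gtail ((t - partial (others j) x) / `|theta j|).
have gE : cmean mu [set~ j]%SET f = EFin \o g.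
  by apply/funext => x; rewrite cmean_halfspace.
have mg : measurable_fun setT g.
  by apply/measurable_EFinP; rewrite -gE; exact: measurable_cmean.
have gg x : 0 <= g x * (1 - g x) by rewrite mulr_ge0 ?subr_ge0 ?gtail_ge0 ?gtail_le1.
(* The width for which [exp(- (t - Y)^2 / theta_j^2)] is a multiple of the centred Gaussian density
   of standard deviation [tau], at [t - Y]. *)
pose tau := `|theta j| / Num.sqrt 2.
have tau0 : 0 < tau by rewrite divr_gt0 ?normr_gt0 ?sqrtr_gt0.
have tau2 : tau ^+ 2 *+ 2 = theta j ^+ 2.
  by rewrite expr_div_n sqr_sqrtr// real_normK ?num_real// -mulr_natr divfK.
rewrite -integral_f (@integral_resample j)// gE.
rewrite -[X in cmoment _ _ X]finset.setIid -(integral_cmean_cmean nuT mu_box)// gE.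
rewrite [leRHS](_ : _ = \int[mu]_x ((g x)%:E * (g x)%:E) +
    \int[mu]_x (g x * (1 - g x))%:E)%E; last first.
  rewrite -ge0_integralD//.
  - apply: eq_integral => x _; rewrite /= -EFinM -EFinD; congr EFin; ring.
  - by move=> x _; rewrite -EFinM lee_fin mulr_ge0 ?gtail_ge0.
  - by apply/measurable_EFinP; exact: measurable_funM.
  - by move=> x _; rewrite lee_fin.
  - by apply/measurable_EFinP; apply: measurable_funM => //; exact: measurable_funB.
rewrite leeD2l//.
have mpdf : measurable_fun setT
    (fun x => normal_pdf 0 tau (t - partial (others j) x)).
  apply: (measurableT_comp (measurable_normal_pdf 0 tau)) => //.
  by apply: measurable_funB => //; exact: measurable_partial.
have ct : 0 <= expR (- 1) / 2 * tau by rewrite mulr_ge0 ?ltW// divr_ge0 ?expR_ge0.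
apply: (@le_trans _ _ (\int[mu]_x ((expR (- 1) / 2 * tau)%:E *
  (normal_pdf 0 tau (t - partial (others j) x))%:E))%E).
  rewrite ge0_integralZl//; last 2 first.
  - exact/measurable_EFinP.
  - by move=> x _; rewrite lee_fin normal_pdf_ge0.
  (* The kernel brings [theta_j^2 / 2] and the other coordinates bring [1 - theta_j^2]. *)
  rewrite integral_smoothing// -EFinM (_ : tau ^+ 2 + _ = 1 - theta j ^+ 2 / 2)//.
  by have := theta_unit; rewrite (othersE j) -tau2 -mulr_natr; lra.
apply: ge0_le_integral => //.
- by move=> x _; rewrite mule_ge0 ?lee_fin ?normal_pdf_ge0.
- by apply: emeasurable_funM => //; exact/measurable_EFinP.
- by apply/measurable_EFinP; apply: measurable_funM => //; exact: measurable_funB.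
- move=> x _; rewrite -EFinM lee_fin.
  apply: le_trans (gtail_variance_lb _).
  rewrite normal_pdfEexp ?gt_eqF// subr0 normal_peakE (gtr0_norm tau0).
  rewrite tau2 expr_div_n real_normK ?num_real//.
  rewrite (_ : _ / 2 * tau * _ = expR (-1) / 2 * normal_peak 1 * (tau / tau) *
    expR (- (t - partial (others j) x) ^+ 2 / theta j ^+ 2)); last by ring.
  by rewrite divff ?gt_eqF// mulr1 mulNr.
Qed.

End halfspace.

(** * Comparison of the constants *)

Lemma powR_three_halves (R : realType) (x : R) :
  0 < x -> x `^ (3 / 2) = x * Num.sqrt x.
Proof.
move=> x0; rewrite (_ : 3 / 2 = 1 + 2^-1); last by lra.
by rewrite powRD ?gt_eqF ?implybT// powRr1 ?ltW// powR12_sqrt ?ltW.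
Qed.

(** This is [sqrt (2 pi) <= pi], from [2 <= pi]; it accounts for the factor [pi] in the theorem. *)
Lemma normal_peak1_lb (R : realType) : (pi : R)^-1 <= normal_peak 1.
Proof.
have pi0 := pi_gt0 R.
have pp : 0 < pi *+ 2 :> R by rewrite pmulrn_lgt0.
rewrite /normal_peak expr1n mul1r lef_pV2 ?posrE ?sqrtr_gt0//.
rewrite -[leRHS]gtr0_norm// -sqrtr_sqr; apply: ler_wsqrtr.
by rewrite -mulr_natl expr2 ler_pM2r// pi_ge2.
Qed.

(** The variance [q] lies between 1/2 and 1: [q <= 1] makes the peak at least [normal_peak 1], and
    [2 q >= 1] makes the exponential at least [exp(- t^2)]. The prefactors agree as
    [2^(3/2) = 2 sqrt 2]. *)
Lemma influence_constant_lb (R : realType) (a t : R) : a ^+ 2 <= 1 ->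
  `|a| / (2 `^ (3 / 2) * pi) * expR (- t ^+ 2 - 1) <=
  expR (- 1) / 2 * (`|a| / Num.sqrt 2) * normal_pdf 0 (Num.sqrt (1 - a ^+ 2 / 2)) t.
Proof.
move=> a1; set q := 1 - a ^+ 2 / 2.
have q2 : 2^-1 <= q by rewrite /q; lra.
have q1 : q <= 1 by rewrite /q; have := sqr_ge0 a; lra.
have q0 : 0 < q by lra.
have sq0 : 0 < Num.sqrt q by rewrite sqrtr_gt0.
have s20 : 0 < Num.sqrt 2 :> R by rewrite sqrtr_gt0.
have pi0 := pi_gt0 R.
rewrite powR_three_halves// expRD.
rewrite (_ : _ / _ * (_ * _) = expR (- 1) / 2 * (`|a| / Num.sqrt 2) *
    (pi^-1 * expR (- t ^+ 2))); last first.
  by move: pi pi0 => p p0; field; rewrite !gt_eqF.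
apply: ler_wpM2l.
  by rewrite mulr_ge0 ?divr_ge0 ?expR_ge0 ?sqrtr_ge0 ?normr_ge0.
rewrite normal_pdfEexp ?gt_eqF// subr0 sqr_sqrtr; last exact: ltW.
apply: ler_pM; first by rewrite invr_ge0 ltW.
- exact: expR_ge0.
- apply: le_trans (normal_peak1_lb R) _.
  rewrite [leRHS]normal_peakE gtr0_norm// ler_peMl ?normal_peak_ge0//.
  by rewrite invf_ge1// -[leRHS]sqrtr1; exact: ler_wsqrtr.
rewrite ler_expR mulNr lerN2 ler_pdivrMr; last by rewrite pmulrn_lgt0.
by rewrite -mulr_natr ler_peMr ?sqr_ge0//; lra.
Qed.

Section halfspace_moment.
Context {R : realType} {n : nat}.
Local Notation V := (n.-tuple R).
Variables (mu : probability V R) (theta : 'I_n -> R) (t : R).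
Hypothesis mu_box : forall B, (forall j, measurable (B j)) ->
  mu (box B) = (\prod_(j < n) normal_prob 0 1 (B j))%E.
Hypothesis theta_unit : \sum_(i < n) theta i ^+ 2 = 1.

Lemma cmoment_halfspaceC j :
  (cmoment mu (fun x => (\1_(halfspace theta t) x)%:E) [set~ j]%SET +
   (`|theta j| / (2 `^ (3 / 2) * pi) * expR (- t ^+ 2 - 1))%:E <=
   (gtail t)%:E)%E.
Proof.
(* The conditional tail divides by [|theta j|]; when this is 0 the added term vanishes. *)
have [j0|j0] := eqVneq (theta j) 0.
  rewrite j0 normr0 !mul0r adde0.
  exact: (cmoment_halfspace_le mu_box theta_unit).
apply: le_trans (cmoment_halfspaceC_neq0 mu_box theta_unit t j0).
rewrite leeD2l// lee_fin influence_constant_lb//.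
by rewrite -theta_unit (bigD1 j)//= lerDl sumr_ge0// => i _; exact: sqr_ge0.
Qed.

End halfspace_moment.

(** * Conditional expectations given some of the coordinates *)

Section cond_exp_unique.
Context {dT : measure_display} {T : measurableType dT} {R : realType}.
Variables (P : probability T R) (D : set_system T).
Hypothesis mD : forall A, D A -> measurable A.

Lemma sub_measurable A : <<s D >> A -> measurable A.
Proof.
by apply: smallest_sub A => //; exact: sigma_algebra_measurable.
Qed.

(** Two integrable functions measurable for [<<s D >>] with equal integrals over its sets agree
    almost everywhere for the restriction of [P]. That restriction is encoded as the pushforward of
    [P] by the identity into [g_sigma_algebraType D]. *)
Lemma is_cond_exp_unique (Y Z Z' : T -> R) :
  is_cond_exp P <<s D >> Y Z -> is_cond_exp P <<s D >> Y Z' ->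
  {ae P, forall w, Z w = Z' w}.
Proof.
move=> [mZ iZ ZY] [mZ' iZ' ZY'].
pose U := g_sigma_algebraType D.
have mid : measurable_fun setT (id : T -> U).
  by move=> _ B mB; rewrite setTI; exact: sub_measurable.
pose toU : {mfun T >-> U} := HB.pack (id : T -> U)
  (isMeasurableFun.Build _ _ _ _ (id : T -> U) mid).
have mG (W : T -> R) : (forall B, measurable B -> <<s D >> (W @^-1` B)) ->
    measurable_fun setT (EFin \o W : U -> \bar R).
  by move=> mW; apply/measurable_EFinP => _ B mB; rewrite setTI; exact: mW.
have intE (W : T -> R) : (forall B, measurable B -> <<s D >> (W @^-1` B)) ->
    P.-integrable setT (EFin \o W) -> forall E : set U, measurable E ->
    (\int[distribution P toU]_(x in E) (W x)%:E =
     \int[P]_(x in E) (W x)%:E)%E.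
  move=> mW iW E mE; rewrite (integral_pushforward mid)//; first exact: mG.
  by apply: integrableS iW => //; exact: sub_measurable.
have : ae_eq (distribution P toU) setT (EFin \o Z) (EFin \o Z').
  apply: integral_ae_eq => //; last 2 first.
  - exact: mG.
  - by move=> E _ mE; rewrite !intE// ZY// ZY'.
  by apply: (integrable_pushforward mid) => //; exact: mG.
move=> [N [mN N0 NZ]]; exists N; split => //; first exact: sub_measurable.
by move=> w /= ZZ'; apply: NZ => /= /(_ I) [].
Qed.

End cond_exp_unique.

Lemma cond_expP {dT : measure_display} {T : measurableType dT} {R : realType}
    (P : probability T R) (G : set_system T) (Y Z : T -> R) :
  is_cond_exp P G Y Z -> is_cond_exp P G Y (cond_exp P G Y).
Proof.
move=> YZ; apply: (@xgetPex _ (fun=> 0) [set Z | is_cond_exp P G Y Z]).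
by exists Z.
Qed.

Section random_vector.
Context {dT : measure_display} {T : measurableType dT} {R : realType}.
Variables (P : probability T R) (n : nat) (X : 'I_n -> {RV P >-> R}).
Local Notation V := (n.-tuple R).

Definition rvector (w : T) : V := [tuple X j w | j < n].

Lemma measurable_rvector : measurable_fun setT rvector.
Proof.
apply/measurable_fun_tnthP => j.
rewrite (_ : _ \o _ = X j); last by apply/funext => w /=; rewrite tnth_mktuple.
exact: measurable_funP.
Qed.

HB.instance Definition _ := isMeasurableFun.Build _ _ _ _ rvector measurable_rvector.

Definition law : probability V R := distribution P rvector.

Lemma integral_law (g : V -> \bar R) : measurable_fun setT g ->
  (forall x, 0 <= g x)%E -> (\int[law]_x g x = \int[P]_w g (rvector w))%E.
Proof. by move=> mg g0; rewrite ge0_integral_distribution. Qed.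

Lemma standard_gaussian_law (B : 'I_n -> set R) : standard_gaussian X ->
  (forall j, measurable (B j)) ->
  law (box B) = (\prod_(j < n) normal_prob 0 1 (B j))%E.
Proof.
move=> [indep gauss] mB.
transitivity (P (\bigcap_(j in [set` [set: 'I_n]%SET]) (X j @^-1` B j))).
  congr (P _); apply/seteqP; split=> w /= Bw.
    by move=> j _; have := Bw j; rewrite tnth_mktuple.
  by move=> j; rewrite tnth_mktuple; apply: Bw; rewrite /= finset.in_setT.
rewrite indep//; apply: eq_big => [j|j _]; first by rewrite finset.in_setT.
by rewrite -(gauss j).
Qed.

Variables (nu : 'I_n -> set R -> \bar R).
Hypothesis nuT : forall j, nu j setT = 1%E.
Hypothesis law_box : forall B, (forall j, measurable (B j)) ->
  law (box B) = (\prod_(j < n) nu j (B j))%E.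
Variable h : V -> R.
Hypotheses (mh : measurable_fun setT h) (h0 : forall x, 0 <= h x)
  (h1 : forall x, h x <= 1).

Let hE (x : V) : \bar R := (h x)%:E.
Let mhE : measurable_fun setT hE. Proof. exact/measurable_EFinP. Qed.
Let hE0 x : (0 <= hE x)%E. Proof. by rewrite lee_fin. Qed.
Let hE1 x : (hE x <= 1)%E. Proof. by rewrite lee_fin. Qed.

Definition rcmean (u : {set 'I_n}) (x : V) : R := fine (cmean law u hE x).

Lemma rcmeanE u x : (rcmean u x)%:E = cmean law u hE x.
Proof.
rewrite /rcmean fineK// ge0_fin_numE ?cmean_ge0//.
by apply: (le_lt_trans (cmean_le1 law u x mhE hE0 hE1)); exact: ltry.
Qed.

Lemma rcmean_ge0 u x : 0 <= rcmean u x.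
Proof. by rewrite fine_ge0 ?cmean_ge0. Qed.

Lemma rcmean_le1 u x : rcmean u x <= 1.
Proof. by rewrite -lee_fin rcmeanE cmean_le1. Qed.

Lemma measurable_rcmean u : measurable_fun setT (rcmean u).
Proof.
apply/measurable_EFinP; rewrite (_ : _ \o _ = cmean law u hE).
  exact: measurable_cmean.
by apply/funext => x; exact: rcmeanE.
Qed.

Let o : V := [tuple 0 | _ < n].

(* A map generating sigma(X_j, j in u): the coordinates outside u are frozen. *)
Let xi (u : {set 'I_n}) (w : T) : V := mix u (rvector w) o.

Let gen (u : {set 'I_n}) : set_system T :=
  \bigcup_(j in [set` u]) preimage_set_system setT (X j) measurable.

Let measurable_gen u A : gen u A -> measurable A.
Proof. by move=> [j _ [B mB <-]]; exact: measurable_funP. Qed.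

Let sigma_xi u (C : set V) : measurable C -> sigma_RVs X u (xi u @^-1` C).
Proof.
have mxi : measurable_fun setT (xi u : g_sigma_algebraType (gen u) -> V).
  apply/measurable_fun_tnthP => j.
  have [ju|ju] := boolP (j \in u).
    rewrite (_ : _ \o _ = X j); last first.
      by apply/funext => w /=; rewrite tnth_mix ju tnth_mktuple.
    move=> _ B mB; apply: sub_sigma_algebra; exists j => //.
    by exists B.
  rewrite (_ : _ \o _ = cst 0)//.
  by apply/funext => w /=; rewrite tnth_mix (negbTE ju) tnth_mktuple.
by move=> mC; have := mxi measurableT _ mC; rewrite setTI.
Qed.

(** The preimages under [xi u] form a sigma-algebra containing the generators. With [sigma_xi],
    [xi u] generates exactly [sigma_RVs X u]. *)
Let xi_sigma u A : sigma_RVs X u A -> exists2 C, measurable C & xi u @^-1` C = A.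
Proof.
pose H := preimage_set_system setT (xi u) (@measurable _ V).
suff : sigma_RVs X u `<=` H by move=> /[apply] -[C mC <-]; exists C; rewrite ?setTI.
apply: smallest_sub.
  exact/sigma_algebra_preimage/sigma_algebra_measurable.
move=> _ [j /= ju [B mB <-]]; exists ((fun x => tnth x j) @^-1` B).
  by rewrite -[X in measurable X]setTI; exact: measurable_tnth.
rewrite !setTI; apply/seteqP.
by split=> w /=; rewrite /xi tnth_mix ju tnth_mktuple.
Qed.

(** [rcmean u] ignores the coordinates outside [u], so it factors through [xi u], whence
    measurability. An event of the sigma-algebra becomes an indicator weight with the same
    invariance, to which [integral_cmeanM] applies. *)
Lemma is_cond_exp_rcmean u :
  is_cond_exp P (sigma_RVs X u) (h \o rvector) (rcmean u \o rvector).
Proof.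
have mr := measurable_rvector.
split.
- move=> B mB; rewrite (_ : _ @^-1` _ = xi u @^-1` (rcmean u @^-1` B)).
    by apply: sigma_xi; rewrite -[X in measurable X]setTI; exact: measurable_rcmean.
  by apply/seteqP; split=> w /=; rewrite /xi /rcmean cmean_mixl.
- apply: measurable_bounded_integrable => //.
  + by rewrite -ge0_fin_numE// fin_num_measure.
  + exact: (measurableT_comp (measurable_rcmean u) mr).
  + exists 1; split=> // M M1 w _; rewrite /= ger0_norm ?rcmean_ge0//.
    exact: le_trans (rcmean_le1 _ _) (ltW M1).
- move=> A /xi_sigma[C mC <-].
  pose k (x : V) : R := \1_C (mix u x o).
  have mk : measurable_fun setT k.
    have mo : measurable_fun setT (fun x : V => mix u x o) by exact: measurable_mix.
    have mi : measurable_fun setT (\1_C : V -> R) by exact: measurable_indic.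
    exact: measurableT_comp mi mo.
  have kE (g : V -> \bar R) : measurable_fun setT g -> (forall x, 0 <= g x)%E ->
      (\int[P]_(w in xi u @^-1` C) g (rvector w) =
       \int[law]_x (g x * (k x)%:E))%E.
    move=> mg g0; rewrite integral_law; last 2 first.
    - by apply: emeasurable_funM => //; exact/measurable_EFinP.
    - by move=> x; rewrite mule_ge0// lee_fin.
    rewrite integral_mkcond; apply: eq_integral => w _.
    rewrite patchE /k indicE.
    have -> : (w \in xi u @^-1` C) = (mix u (rvector w) o \in C).
      by apply/idP/idP; rewrite !inE.
    by case: ifP; rewrite ?mule1 ?mule0.
  under eq_integral do rewrite /= rcmeanE.
  rewrite (kE hE)// (kE (cmean law u hE)); last 2 first.
  - exact: measurable_cmean.
  - by move=> x; exact: cmean_ge0.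
  rewrite (integral_cmeanM nuT law_box)//.
  + exact/measurable_EFinP.
  + by move=> x; rewrite lee_fin.
  + by move=> x y; rewrite /k mix_mixl.
Qed.

(** [cond_exp] is an unspecified version, so it matches the explicit one only almost everywhere. *)
Lemma cond_exp_rcmean u :
  let Z := cond_exp P (sigma_RVs X u) (h \o rvector) in
  measurable_fun setT Z /\ {ae P, forall w, Z w = rcmean u (rvector w)}.
Proof.
have H := is_cond_exp_rcmean u; have H' := cond_expP H.
split; last exact: is_cond_exp_unique (@measurable_gen u) _ _ _ H' H.
by case: H' => _ /measurable_int/measurable_EFinP.
Qed.

End random_vector.

(** * ANOVA variances *)

Section ess_bounded.
Context {dT : measure_display} {T : measurableType dT} {R : realType}.
Variable P : probability T R.

(** The bound is almost sure because the chosen versions of conditional expectations need not be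
    bounded everywhere. The class is closed under the operations building ANOVA components and their
    products, and makes them integrable. *)
Definition ess_bounded (W : T -> R) :=
  measurable_fun setT W /\ exists C, {ae P, forall w, `|W w| <= C}.

Lemma ess_boundedD W1 W2 : ess_bounded W1 -> ess_bounded W2 ->
  ess_bounded (fun w => W1 w + W2 w).
Proof.
move=> [m1 [C1 b1]] [m2 [C2 b2]]; split; first exact: measurable_funD.
exists (C1 + C2); apply: filterS2 b1 b2 => w h1 h2.
by rewrite (le_trans (ler_normD _ _))// lerD.
Qed.

Lemma ess_boundedN W : ess_bounded W -> ess_bounded (fun w => - W w).
Proof.
move=> [m [C b]]; split; first exact: measurableT_comp.
by exists C; apply: filterS b => w; rewrite normrN.
Qed.

Lemma ess_boundedM W1 W2 : ess_bounded W1 -> ess_bounded W2 ->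
  ess_bounded (fun w => W1 w * W2 w).
Proof.
move=> [m1 [C1 b1]] [m2 [C2 b2]]; split; first exact: measurable_funM.
exists (C1 * C2); apply: filterS2 b1 b2 => w h1 h2.
by rewrite normrM ler_pM.
Qed.

Lemma ess_bounded_sum (I : Type) (s : seq I) (Q : pred I) (W : I -> T -> R) :
  (forall i, Q i -> ess_bounded (W i)) ->
  ess_bounded (fun w => \sum_(i <- s | Q i) W i w).
Proof.
move=> bW; elim: s => [|i s IH].
  rewrite (_ : (fun _ => _) = cst 0); last by apply/funext => w; rewrite big_nil.
  split; first exact: measurable_cst.
  by exists 0; apply: aeW => w; rewrite normr0.
rewrite (_ : (fun _ => _) = if Q i
    then fun w => W i w + \sum_(i <- s | Q i) W i w
    else fun w => \sum_(i <- s | Q i) W i w); last first.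
  by apply/funext => w; rewrite big_cons; case: ifP.
by case: ifP => // Qi; apply: ess_boundedD => //; exact: bW.
Qed.

Lemma ess_bounded_integrable W : ess_bounded W ->
  P.-integrable setT (EFin \o W).
Proof.
move=> [m [C b]]; apply/integrableP; split; first exact/measurable_EFinP.
apply: (@le_lt_trans _ _ (\int[P]_w (cst `|C|%:E w))%E); last first.
  by rewrite integral_cst_probability ltry.
apply: ae_ge0_le_integral => //.
- by apply/measurable_EFinP; exact: measurableT_comp.
- by move=> w _; rewrite lee_fin.
- by apply: filterS b => w h _; rewrite /= lee_fin (le_trans h)// ler_norm.
Qed.

Lemma Rintegral_sum (I : Type) (s : seq I) (Q : pred I) (W : I -> T -> R) :
  (forall i, Q i -> ess_bounded (W i)) ->
  \int[P]_w (\sum_(i <- s | Q i) W i w) = \sum_(i <- s | Q i) \int[P]_w W i w.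
Proof.
move=> bW; elim: s => [|i s IH].
  rewrite big_nil; under eq_Rintegral do rewrite big_nil.
  by rewrite Rintegral_cst// mul0r.
rewrite big_cons; under eq_Rintegral do rewrite big_cons.
case: ifP => // Qi; rewrite RintegralD ?IH//; apply: ess_bounded_integrable.
  exact: bW.
exact: ess_bounded_sum.
Qed.

End ess_bounded.

Section anova_moments.
Context {dT : measure_display} {T : measurableType dT} {R : realType}.
Variables (P : probability T R) (n : nat) (X : 'I_n -> {RV P >-> R}).
Local Notation V := (n.-tuple R).
Variables (nu : 'I_n -> set R -> \bar R).
Hypothesis nuT : forall j, nu j setT = 1%E.
Hypothesis law_box : forall B, (forall j, measurable (B j)) ->
  law X (box B) = (\prod_(j < n) nu j (B j))%E.
Variables (f : 'cV[R]_n -> R) (h : V -> R).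
Hypotheses (mh : measurable_fun setT h) (h0 : forall x, 0 <= h x)
  (h1 : forall x, h x <= 1).
Hypothesis fh : apply_RVs X f = h \o rvector X.

Let Z u := cond_exp P (sigma_RVs X u) (apply_RVs X f).

Let Z_rcmean u :
  measurable_fun setT (Z u) /\ {ae P, forall w, Z u w = rcmean X h u (rvector X w)}.
Proof. by rewrite /Z fh; have := cond_exp_rcmean nuT law_box mh h0 h1 u. Qed.

Let bZ u : ess_bounded P (Z u).
Proof.
have [mZ Zr] := Z_rcmean u; split => //; exists 1; apply: filterS Zr => w ->.
by rewrite ger0_norm ?rcmean_ge0// rcmean_le1.
Qed.

Lemma sum_anova (u : {set 'I_n}) w :
  \sum_(v : {set 'I_n} | v \subset u) anova X f v w = Z u w.
Proof.
rewrite (bigD1 u)//= [anova X f u w]anovaE -[RHS]addr0 -addrA; congr (_ + _).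
apply/eqP; rewrite addrC subr_eq0; apply/eqP; apply: eq_bigl => v.
by rewrite finset.properEneq andbC.
Qed.

Lemma ess_bounded_anova (u : {set 'I_n}) : ess_bounded P (anova X f u).
Proof.
elim: {u}_.+1 {-2}u (ltnSn #|u|) => // m IH u um.
rewrite (_ : anova X f u = fun w => Z u w +
    - (\sum_(v : {set 'I_n} | v \proper u) anova X f v w)); last first.
  by apply/funext => w; exact: anovaE.
apply: ess_boundedD => //; apply: ess_boundedN; apply: ess_bounded_sum => v vu.
by apply: IH; rewrite (leq_trans (fintype.proper_card vu)).
Qed.

Definition anova_product u v : R := \int[P]_w (anova X f u w * anova X f v w).

Definition rcmoment u : R := fine (cmoment (law X) (fun x => (h x)%:E) u).

(** The components below [u] add up to [Z u] pointwise, so bilinearity gives [E(Z u * Z v)]; the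
    versions are then replaced by the explicit conditional means. This is the hypothesis [sum_p] of
    the Gram matrix lemmas. *)
Lemma sum_anova_product (u v : {set 'I_n}) :
  \sum_(u' : {set 'I_n} | u' \subset u) \sum_(v' : {set 'I_n} | v' \subset v)
    anova_product u' v' = rcmoment (u :&: v)%SET.
Proof.
have bb u' v' := ess_boundedM (ess_bounded_anova u') (ess_bounded_anova v').
transitivity (\int[P]_w (Z u w * Z v w)).
  under eq_Rintegral do rewrite -!sum_anova big_distrlr/=.
  rewrite Rintegral_sum; last by move=> u' _; exact: ess_bounded_sum.
  by apply: eq_bigr => u' _; rewrite Rintegral_sum.
rewrite /rcmoment -(integral_cmean_cmean nuT law_box)//; last exact/measurable_EFinP.
congr fine; rewrite integral_law; last 2 first.
- by apply: emeasurable_funM; apply: measurable_cmean => //;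
    exact/measurable_EFinP.
- by move=> x; rewrite mule_ge0// cmean_ge0// => y; rewrite lee_fin.
have [mZu Zu] := Z_rcmean u; have [mZv Zv] := Z_rcmean v.
apply: ae_eq_integral => //.
- by apply/measurable_EFinP; exact: measurable_funM.
- under eq_fun do rewrite -!(rcmeanE X mh h0 h1) -EFinM.
  apply/measurable_EFinP; apply: measurable_funM;
    apply: measurableT_comp (measurable_rvector X); exact: measurable_rcmean.
- apply: filterS2 Zu Zv => w -> -> _.
  by rewrite -!(rcmeanE X mh h0 h1).
Qed.

Lemma anova_productC u v : anova_product u v = anova_product v u.
Proof. by apply: eq_Rintegral => w _; rewrite mulrC. Qed.

Lemma anova_varianceE (u : {set 'I_n}) : u != finset.set0 ->
  anova_variance X f u = anova_product u u.
Proof.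
move=> /negbTE u0; rewrite /anova_variance u0 unlock.
by congr fine; apply: eq_integral => w _; rewrite expr2.
Qed.

Lemma mean_dimension_rcmoment : mean_dimension X f =
  (\sum_(j < n) (rcmoment [set: 'I_n]%SET - rcmoment [set~ j]%SET)) /
  (rcmoment [set: 'I_n]%SET - rcmoment finset.set0).
Proof.
rewrite /mean_dimension; congr (_ / _).
  rewrite -(gram_sum_card anova_productC sum_anova_product).
  apply: eq_bigr => u _; have [->|u0] := eqVneq u finset.set0.
    by rewrite cards0 !mul0r.
  by rewrite anova_varianceE.
(* [anova_variance] is 0 at the empty set whereas the Gram diagonal there is [E(f)^2]: subtracting
   the moment of the empty set removes this term. In the numerator the weight 0 does so. *)
rewrite -!(gram_diagonal anova_productC sum_anova_product).
rewrite (bigD1 finset.set0)//= [anova_variance _ _ _]/anova_variance eqxx add0r.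
rewrite [X in _ = X - _](bigD1 finset.set0) ?finset.sub0set//=.
rewrite [X in _ = _ - X](big_pred1 finset.set0); last first.
  by move=> u; rewrite finset.subset0.
rewrite [RHS]addrC addKr; apply: eq_big => [u|u]; first by rewrite finset.subsetT.
exact: anova_varianceE.
Qed.

End anova_moments.

(** * The lower bound on the mean dimension *)

Unset Implicit Arguments.
Set Strict Implicit.
Set Printing Implicit Defensive.

Theorem theorem4p2 (R : realType) (dT : measure_display)
    (T : measurableType dT) (P : probability T R)
    (d : nat) (X : 'I_d -> {RV P >-> R}) (theta : 'cV[R]_d) (t : R) :
  (2 <= d)%N -> standard_gaussian X -> norm2 theta = 1 -> 0 <= t ->
  mean_dimension X (\1_[set x : 'cV[R]_d | (theta^T *m x) 0 0 > t]) >=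
  norm1 theta / (Phi t * Phi (- t) * (2 `^ (3 / 2)) * pi) *
  expR (- t ^+ 2 - 1).
Proof.
move=> _ gX theta1 _.
pose th (j : 'I_d) : R := theta j 0.
have th1 : \sum_(j < d) th j ^+ 2 = 1.
  have s0 : 0 <= \sum_(j < d) th j ^+ 2 by apply: sumr_ge0 => j _; exact: sqr_ge0.
  by rewrite -(sqr_sqrtr s0) -[Num.sqrt _]/(norm2 theta) theta1 expr1n.
pose H := halfspace th t.
have law_box (B : 'I_d -> set R) (mB : forall j, measurable (B j)) :=
  standard_gaussian_law gX mB.
have nuT (j : 'I_d) : @normal_prob R 0 1 setT = 1%E by exact: probability_setT.
have mH : measurable_fun setT (\1_H : d.-tuple R -> R).
  by apply: measurable_indic; exact: measurable_halfspace.
have H0 (x : d.-tuple R) : 0 <= \1_H x :> R by [].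
have H1 (x : d.-tuple R) : \1_H x <= 1 :> R by rewrite indicE; case: (_ \in _).
(* Passage from column vectors to tuples, where the product measure lives. *)
have fH : apply_RVs X (\1_[set x : 'cV[R]_d | (theta^T *m x) 0 0 > t]) =
    \1_H \o rvector X.
  apply/funext => w; rewrite /apply_RVs /= !indicE; congr (_%:R).
  congr (nat_of_bool _); apply: asbool_equiv_eq; rewrite /H /halfspace /= mxE.
  rewrite (eq_bigr (fun j => th j * tnth (rvector X w) j))// => j _.
  by rewrite !mxE tnth_mktuple.
rewrite (mean_dimension_rcmoment (nu := fun=> normal_prob 0 1)
  nuT law_box mH H0 H1 fH).
set M := rcmoment X _.
have MT : M [set: 'I_d]%SET = gtail t.
  by rewrite /M /rcmoment (cmoment_halfspaceT law_box th1).
have M0 : M finset.set0 = gtail t ^+ 2.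
  by rewrite /M /rcmoment (cmoment_halfspace0 law_box th1).
rewrite MT M0 Phi_gtail PhiN_gtail.
have -> : gtail t - gtail t ^+ 2 = (1 - gtail t) * gtail t by rewrite expr2; ring.
set D := (1 - gtail t) * gtail t.
have D0 : 0 <= D by rewrite mulr_ge0 ?subr_ge0 ?gtail_le1 ?gtail_ge0.
rewrite -[D * _ * _]mulrA; set A := _ * pi; set e := expR _.
(* With the variance [D] isolated on both sides, [norm1 theta] is compared with the numerator one
   coordinate at a time. *)
rewrite (_ : _ * e = norm1 theta / A * e / D); last by rewrite invfM; ring.
apply: ler_wpM2r; first by rewrite invr_ge0.
rewrite /norm1 !mulr_suml; apply: ler_sum => j _.
have := cmoment_halfspaceC t law_box th1 j.
rewrite -[cmoment _ _ _]fineK; last first.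
  rewrite ge0_fin_numE; last first.
    by apply: integral_ge0 => x _; rewrite mule_ge0 ?cmean_ge0// lee_fin.
  by apply: le_lt_trans (cmoment_halfspace_le law_box th1 t _) _; exact: ltry.
rewrite -EFinD lee_fin addrC -lerBrDr.
exact.
Qed.
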